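(* Let $p,q$ be distinct primes. If there are infinitely many pairs $(i,j)$ of positive integers such that $c=p^i+q^j$ is prime, then along these pairs $$q_{\mathrm{DGM}}(p^i,q^j,c)=\frac{(\ln c)^{2/3}}{3\sqrt[3]{\ln p\,\ln q}}\to\infty ,$$ so that $\limsup_{c\to\infty}s_c=\infty$.
   Context: An abc-triple is a triple $(a,b,c)$ of positive integers with $a+b=c$ and $\gcd(a,b)=\gcd(b,c)=\gcd(a,c)=1$. For an abc-triple, $\omega=\omega(abc)$ is the number of distinct primes $p_1,\dots,p_\omega$ dividing $abc$. For a finite set $S=\{x_1,\dots,x_k\}$ of positive reals, $\mathrm{DGM}(S)=\exp\big(\exp\big(\tfrac1k\sum_{i=1}^k\ln\ln x_i\big)\big)$. The DGM quality is $q_{\mathrm{DGM}}(a,b,c)=\dfrac{\ln c}{\ln(\mathrm{DGM}(\{p^\omega: p\mid abc,\ p\text{ prime}\}))}$, equivalently $q_{\mathrm{DGM}}(a,b,c)=\dfrac{\ln c}{\omega\,\big(\prod_{i=1}^{\omega}\ln p_i\big)^{1/\omega}}$. For an integer $c\ge 2$, $s_c=\max\{q_{\mathrm{DGM}}(a,b,c):(a,b,c)\text{ is an abc-triple}\}$, the maximum being over $a,b$ with $c$ fixed. *)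

(* Defs.v *)
From HB Require Import structures.
From mathcomp Require Import all_boot all_order all_algebra finmap.
From mathcomp Require Import all_classical all_reals all_analysis.

Set Implicit Arguments.
Unset Strict Implicit.
Unset Printing Implicit Defensive.

Import Order.TTheory GRing.Theory Num.Theory.
Import numFieldNormedType.Exports.

Local Open Scope classical_set_scope.
Local Open Scope ring_scope.

Definition abc_triple (a b c : nat) : Prop :=
  [/\ [/\ (0 < a)%N, (0 < b)%N & (0 < c)%N], (a + b)%N = c
    & [/\ coprime a b, coprime b c & coprime a c]].

Definition omega (n : nat) : nat := size (primes n).

Definition DGM (R : realType) (S : {fset R}) : R :=
  expR (expR ((#|` S|%:R)^-1 * \sum_(x <- S) ln (ln x))).

Definition qDGM (R : realType) (a b c : nat) : R :=
  let n := (a * b * c)%N in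
  ln c%:R / ln (DGM [fset (p%:R : R) ^+ omega n | p in primes n]%fset).

(* The maximum of q over the (finitely many) abc-triples with sum c; for
   c >= 2 the supremum is attained, see [sDGM_max].  The values at c = 0 and
   c = 1, where there is no abc-triple, are irrelevant. *)
Definition sDGM (R : realType) (c : nat) : R :=
  sup [set x | exists a b, abc_triple a b c /\ x = qDGM R a b c].

(* The filter of cofinite subsets of P: [f x @[x --> along P] --> l] means that
   f tends to l as x runs through the elements of P, in any order. *)
Definition along (T : Type) (P : set T) : set_system T :=
  [set A | finite_set (P `\` A)].

Definition prime_sum_pairs (p q : nat) : set (nat * nat) :=
  [set ij | [/\ (0 < ij.1)%N, (0 < ij.2)%N & prime (p ^ ij.1 + q ^ ij.2)]].

#[global] Instance along_filter (T : Type) (P : set T) : Filter (along P).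
Proof.
split; first by rewrite /along /= setDT; exact: finite_set0.
  move=> A B fA fB; rewrite /along /= setDIr.
  by rewrite finite_setU; split.
by move=> A B AB; rewrite /along /=; apply: sub_finite_set; exact: setDS.
Qed.

Lemma abc_triple_1 (c : nat) : (2 <= c)%N -> abc_triple 1 c.-1 c.
Proof. by case: c => [|[|c]] // _; split=> //; rewrite ?coprime1n ?coprimenS. Qed.

Lemma sDGM_max (R : realType) (c : nat) : (2 <= c)%N ->
  exists a b, [/\ abc_triple a b c, sDGM R c = qDGM R a b c
    & forall a' b', abc_triple a' b' c -> qDGM R a' b' c <= qDGM R a b c].
Proof.
move=> c2; pose P (i : 'I_c) := `[< abc_triple i (c - i) c >].
have P1 : P (Ordinal c2).
  by apply/asboolP => /=; rewrite subn1; exact: abc_triple_1.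
have [i /asboolP Pi imax] :=
  @arg_maxP _ _ _ (Ordinal c2) P (fun i : 'I_c => qDGM R i (c - i) c) P1.
have ub a b : abc_triple a b c -> qDGM R a b c <= qDGM R i (c - i) c.
  move=> abc; have [[_ b0 _] abE _] := abc.
  have ac : (a < c)%N by rewrite -abE -addn1 leq_add2l.
  have bE : b = (c - a)%N by rewrite -abE addKn.
  by have := imax (Ordinal ac); rewrite /= -bE; apply; apply/asboolP; rewrite /= -bE.
exists i, (c - i)%N; split=> //.
have ubS : ubound [set x | exists a b, abc_triple a b c /\ x = qDGM R a b c]
    (qDGM R i (c - i) c).
  by move=> _ [a [b [abc ->]]]; exact: ub.
apply/eqP; rewrite eq_le; apply/andP; split.
  by apply: ge_sup ubS; exists (qDGM R i (c - i) c), i, (c - i)%N.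
by apply: ub_le_sup; [exists (qDGM R i (c - i) c) | exists i, (c - i)%N].
Qed.

Lemma qDGME (R : realType) (a b c : nat) : abc_triple a b c ->
  let n := (a * b * c)%N in let w := omega n in
  qDGM R a b c =
  ln c%:R / (w%:R * (\prod_(p <- primes n) ln p%:R) `^ (w%:R)^-1).
Proof.
move=> [[a0 b0 c0] abE _] n w; rewrite /qDGM /DGM expRK -/n -/w; congr (_ / _).
have n2 : (1 < n)%N.
  have : (1 < c)%N by rewrite -abE (leq_add a0 b0).
  by move=> c1; rewrite (leq_trans c1)// leq_pmull// muln_gt0 a0.
have w0 : (0 < w)%N.
  by rewrite /w /omega -has_predT; apply/hasP; exists (pdiv n) => //;
    rewrite mem_primes pdiv_prime// pdiv_dvd (ltnW n2).
have lnp0 (p : nat) : p \in primes n -> 0 < ln (p%:R : R).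
  by rewrite mem_primes => /andP[/prime_gt1 p1 _]; rewrite ln_gt0// ltr1n.
have inj : {in primes n &, injective (fun p : nat => (p%:R : R) ^+ w)}.
  by move=> x y _ _ /eqP; rewrite eqrXn2// => /eqP/eqP; rewrite eqr_nat => /eqP.
rewrite card_in_imfset//= big_imfset//=.
rewrite (undup_id (primes_uniq n)) -[size _]/w.
have wR0 : (w%:R : R) != 0 by rewrite pnatr_eq0 -lt0n.
have prod0 : 0 < \prod_(p <- primes n) ln (p%:R : R).
  by rewrite big_seq; apply: prodr_gt0.
have -> : \sum_(p <- primes n) ln (ln ((p%:R : R) ^+ w)) =
    w%:R * ln w%:R + ln (\prod_(p <- primes n) ln (p%:R : R)).
  have -> : ln (\prod_(p <- primes n) ln (p%:R : R)) =
      \sum_(p <- primes n) ln (ln (p%:R : R)).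
    elim: (primes n) lnp0 => [|p r IH] pr; first by rewrite !big_nil ln1.
    have rpos (q : nat) : q \in r -> 0 < ln (q%:R : R).
      by move=> qr; apply: pr; rewrite inE qr orbT.
    rewrite !big_cons lnM ?IH// posrE; first by apply: pr; rewrite inE eqxx.
    by rewrite big_seq; apply: prodr_gt0.
  transitivity (\sum_(p <- primes n) (ln w%:R + ln (ln (p%:R : R)))).
    rewrite !big_seq; apply: eq_bigr => p pn; have p0 : 0 < (p%:R : R).
      by rewrite ltr0n; move: pn; rewrite mem_primes => /andP[/prime_gt0].
    by rewrite lnXn// -[ln p%:R *+ w]mulr_natl lnM ?posrE ?ltr0n//; exact: lnp0.
  by rewrite big_split/= big_const_seq count_predT iter_addr_0 mulr_natl.
rewrite mulrDr mulKf// expRD lnK ?posrE ?ltr0n//.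
by rewrite /powR gt_eqF.
Qed.

(* Main.v *)
(* If c = p^i + q^j is prime then p, q, c are exactly the primes dividing abc, so
   omega = 3 and two of the three logarithms in the geometric mean stay fixed
   while the third is ln c itself; only finitely many (i, j) give c below a given
   bound, hence c, and with it (ln c)^(2/3), tends to infinity. *)
Require Import Defs.
From mathcomp Require Import all_boot all_order all_algebra finmap.
From mathcomp Require Import all_classical all_reals all_analysis.
From mathcomp Require Import lra.
Import Order.TTheory GRing.Theory Num.Theory.
Import numFieldNormedType.Exports.
Local Open Scope classical_set_scope.
Local Open Scope ring_scope.

Lemma along_self (T : Type) (P : set T) : along P P.
Proof. by rewrite /along /= setDv; exact: finite_set0. Qed.

(** The empty set belongs to [along P] exactly when [P] is finite. Properness is what turns an
    eventual statement into an actual element of [P]. *)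
Lemma along_proper (T : Type) (P : set T) :
  infinite_set P -> ProperFilter (along P).
Proof.
move=> infP; split; last exact: along_filter.
by rewrite /along /= setD0.
Qed.

(** Up to permutation only: [primes] is increasing, while [p] and [q] come in no fixed order. Size
    and product ignore the order. *)
Lemma primes_mul3 (p q r i j : nat) :
  prime p -> prime q -> prime r -> (0 < i)%N -> (0 < j)%N ->
  uniq [:: p; q; r] -> perm_eq (primes (p ^ i * q ^ j * r)) [:: p; q; r].
Proof.
move=> pp pq pr i0 j0 uniq_pqr; apply: uniq_perm; rewrite ?primes_uniq// => x.
rewrite !primesM ?muln_gt0 ?expn_gt0 ?prime_gt0// !primesX// !primes_prime//.
by rewrite !inE orbA.
Qed.

Lemma prime_sum_uniq (p q i j : nat) : prime p -> prime q -> p <> q ->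
  prime_sum_pairs p q (i, j) -> uniq [:: p; q; (p ^ i + q ^ j)%N].
Proof.
move=> pp pq /eqP pNq [/= i0 j0 _].
(* Positive exponents give [p <= p ^ i < c] and [q <= q ^ j < c]. *)
rewrite /= !inE negb_or pNq/= andbT; apply/andP; split.
  rewrite neq_ltn (leq_ltn_trans (_ : p <= p ^ i)%N)//.
    by rewrite -{1}(expn1 p) leq_exp2l// prime_gt1.
  by rewrite -addn1 leq_add2l expn_gt0 prime_gt0.
rewrite neq_ltn (leq_ltn_trans (_ : q <= q ^ j)%N)//.
  by rewrite -{1}(expn1 q) leq_exp2l// prime_gt1.
by rewrite addnC -addn1 leq_add2l expn_gt0 prime_gt0.
Qed.

Lemma prime_sum_abc (p q i j : nat) : prime p -> prime q -> p <> q ->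
  prime_sum_pairs p q (i, j) -> abc_triple (p ^ i) (q ^ j) (p ^ i + q ^ j).
Proof.
move=> pp pq /eqP pNq _.
have coab : coprime (p ^ i) (q ^ j).
  by rewrite coprimeXl// coprimeXr// prime_coprime// dvdn_prime2.
split=> //; split; rewrite ?addn_gt0 ?expn_gt0 ?prime_gt0//.
- by rewrite /coprime gcdnDr gcdnC.
- by rewrite /coprime gcdnDl.
Qed.

Lemma qDGM_prime_sum (R : realType) (p q i j : nat) :
  prime p -> prime q -> p <> q -> prime_sum_pairs p q (i, j) ->
  let c := (p ^ i + q ^ j)%N in
  qDGM R (p ^ i) (q ^ j) c =
  (ln c%:R) `^ (2 / 3) / (3 * (ln p%:R * ln q%:R) `^ (3^-1)).
Proof.
move=> pp pq pNq ij c.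
have [/= i0 j0 pc] := ij.
have perm : perm_eq (primes (p ^ i * q ^ j * c)) [:: p; q; c].
  by apply: primes_mul3 => //; exact: prime_sum_uniq.
have lnp0 (r : nat) : prime r -> 0 < ln (r%:R : R).
  by move=> /prime_gt1 r1; rewrite ln_gt0// ltr1n.
rewrite qDGME; last exact: prime_sum_abc.
rewrite /omega -/c (perm_size perm) (perm_big _ perm)/= !big_cons big_nil mulr1.
have [lp lq lc] : [/\ 0 < ln (p%:R : R), 0 < ln (q%:R : R) & 0 < ln (c%:R : R)].
  by split; exact: lnp0.
rewrite [ln p%:R * _ in LHS]mulrA powRM ?mulr_ge0 ?ltW//.
(* The geometric mean contains the factor [ln c] to the power 1/3, which is divided out of the
   numerator [ln c]. *)
have -> : (2 / 3 : R) = 1 - 3^-1 by lra.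
rewrite powRB ?lt0r_neq0 ?implybT// powRr1 ?ltW//.
by rewrite [3 * _ in LHS]mulrA [in LHS]invfM mulrCA mulrC -mulrA [_^-1 / _]mulrC.
Qed.

(** Since [i < p ^ i] and [j < q ^ j], a sum below [N] forces both exponents below [N], so the
    exceptional pairs lie in a finite square. *)
Lemma prime_sum_cvgy (p q : nat) : prime p -> prime q ->
  (p ^ ij.1 + q ^ ij.2)%N @[ij --> along (prime_sum_pairs p q)] --> \oo.
Proof.
move=> pp pq A [N _ NA]; rewrite /nbhs/= /along/=.
apply: (@sub_finite_set _ _ (`I_N `*` `I_N)).
  move=> [i j] [_ /= nA]; have cN : (p ^ i + q ^ j < N)%N.
    by rewrite ltnNge; apply/negP => Nc; apply: nA; exact: NA.
  by split=> /=; apply: leq_ltn_trans cN;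
    [rewrite (leq_trans _ (leq_addr _ _))// | rewrite (leq_trans _ (leq_addl _ _))//];
    rewrite ltnW// ltn_expl// prime_gt1.
by apply: finite_setX; exact: finite_II.
Qed.

Lemma ln_powR_cvgy (R : realType) (a : R) : 0 < a ->
  (ln n%:R : R) `^ a @[n --> \oo] --> +oo.
Proof.
move=> a0; apply/cvgryPge => A.
near=> n.
have A1 : A <= Num.max A 0 by rewrite le_max lexx.
have M0 : 0 <= Num.max A 0 by rewrite le_max lexx orbT.
apply: (le_trans A1); set M := Num.max A 0 in M0 *.
have ME : M = (M `^ a^-1) `^ a.
  by rewrite -powRrM mulVf ?gt_eqF// powRr1.
have Mn : expR (M `^ a^-1) <= n%:R.
  by near: n; exact: nbhs_infty_ger.
have Mln : M `^ a^-1 <= ln n%:R.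
  by rewrite -[leLHS]expRK ler_ln ?posrE ?expR_gt0 ?(lt_le_trans (expR_gt0 _) Mn).
have ln0 : 0 <= ln (n%:R : R) by apply: le_trans Mln; exact: powR_ge0.
by rewrite [leLHS]ME; apply: (ge0_ler_powR (ltW a0)); rewrite ?nnegrE ?powR_ge0.
Unshelve. all: by end_near. Qed.

(** The limsup is the infimum of the suprema of [u] over neighbourhoods of infinity. Each contains a
    tail, on which [u] is unbounded, so every supremum is infinite. *)
Lemma limn_esup_pinfty (R : realType) (u : nat -> R) :
  (forall A N, exists2 n, (N <= n)%N & A <= u n) ->
  limn_esup (fun n => (u n)%:E) = +oo%E.
Proof.
move=> uA; apply/eqP; rewrite -leye_eq; apply/ereal_infP => _ [V [N _ NV] <-].
rewrite leye_eq; apply/eqP/eqyP => A _.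
have [n Nn An] := uA A N.
apply: (@le_trans _ _ (u n)%:E); first by rewrite lee_fin.
by apply: ereal_sup_ubound; exists n => //; exact: NV.
Qed.

Theorem theorem3p6 (R : realType) (p q : nat)
    (hp : prime p) (hq : prime q) (hpq : p <> q)
    (hinf : infinite_set (prime_sum_pairs p q)) :
  [/\ forall i j : nat, prime_sum_pairs p q (i, j) ->
        let c := (p ^ i + q ^ j)%N in
        qDGM R (p ^ i) (q ^ j) c =
        (ln c%:R) `^ (2 / 3) / (3 * (ln p%:R * ln q%:R) `^ (3^-1)),
      qDGM R (p ^ ij.1) (q ^ ij.2) (p ^ ij.1 + q ^ ij.2)
        @[ij --> along (prime_sum_pairs p q)] --> +oo
    & limn_esup (fun c : nat => (sDGM R c)%:E) = +oo%E].
Proof.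
have qE i j : prime_sum_pairs p q (i, j) -> _ := @qDGM_prime_sum R p q i j hp hq hpq.
have qcvg : qDGM R (p ^ ij.1) (q ^ ij.2) (p ^ ij.1 + q ^ ij.2)
    @[ij --> along (prime_sum_pairs p q)] --> +oo.
  have K0 : 0 < 3 * (ln p%:R * ln q%:R : R) `^ 3^-1.
    by rewrite mulr_gt0// powR_gt0// mulr_gt0// ln_gt0// ltr1n prime_gt1.
  have lncvg : (ln (p ^ ij.1 + q ^ ij.2)%:R : R) `^ (2 / 3)
      @[ij --> along (prime_sum_pairs p q)] --> +oo.
    have a0 : 0 < 2 / 3 :> R by rewrite divr_gt0.
    exact: (cvg_comp _ _ (prime_sum_cvgy _ _ hp hq) (ln_powR_cvgy _ _ a0)).
  apply/cvgryPge => A.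
  (* The bound [A] is scaled by the constant denominator, positive by [K0]. *)
  move/cvgryPge: lncvg => /(_ (A * (3 * (ln p%:R * ln q%:R : R) `^ 3^-1))) lnA.
  near=> ij.
  have ijP : prime_sum_pairs p q (ij.1, ij.2).
    by rewrite -surjective_pairing; near: ij; exact: along_self.
  by rewrite qE// ler_pdivlMr//; near: ij.
split=> //; apply: limn_esup_pinfty => A N.
have PF := along_proper _ _ hinf.
have qA : \forall ij \near along (prime_sum_pairs p q),
    A <= qDGM R (p ^ ij.1) (q ^ ij.2) (p ^ ij.1 + q ^ ij.2).
  by move/cvgryPge : qcvg; exact.
have cN : \forall ij \near along (prime_sum_pairs p q),
    (N <= p ^ ij.1 + q ^ ij.2)%N.
  exact: (prime_sum_cvgy _ _ hp hq _ (nbhs_infty_ge N)).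
(* One pair with large quality, large sum and prime sum at once. *)
have [[i j] [[/= Aq Nc] ijP]] := filter_ex (filterI (filterI qA cN) (along_self _ _)).
exists (p ^ i + q ^ j)%N => //; apply: (le_trans Aq).
have [_ _ /prime_gt1 c1] := ijP.
(* As [c >= 2], [sDGM R c] is an attained maximum, so it dominates the quality of the triple at
   hand. *)
have [a [b [_ -> qmax]]] := @sDGM_max R _ c1.
exact/qmax/prime_sum_abc.
Unshelve. all: by end_near. Qed.
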